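(* Assume that $\overline{I}_i=\overline{\sigma}_i$ on non-negative functions, for every $i\ge0$. Let $f\in\mathcal{L}_{\overline{\sigma}_0}$ and $0\le j\le k$. Then $$\int_k\Big[\int_jf\Big]=\int_jf\doteq\int_j\Big[\int_kf\Big].$$ Moreover, assuming also that $|f|\in\mathcal{L}_{\overline{\sigma}_0}$: if $\|f\|_k\doteq0$ then $f$ is a null function, i.e. $\|f\|=0$.
   Context: Setting. Fix $s_0\in\mathbb{R}$ and a trajectory set $\mathcal{S}$, i.e. a (nonempty) set of real sequences $S=(S_i)_{i\ge0}$ with $S_0=s_0$. For $S\in\mathcal{S}$ and $j\ge0$ let $\mathcal{S}_{(S,j)}=\{\tilde S\in\mathcal{S}:\tilde S_i=S_i,\ 0\le i\le j\}$; the pair $(S,j)$ is called a node. Put $\Delta_iS=S_{i+1}-S_i$. For every node a set $\mathcal{H}_{(S,j)}$ of portfolios is given (depending only on the node, i.e. $\mathcal H_{(\tilde S,j)}=\mathcal H_{(S,j)}$ if $\tilde S\in\mathcal S_{(S,j)}$): its elements are sequences $H=(H_i)_{i\ge j}$ of functions $H_i:\mathcal{S}_{(S,j)}\to\mathbb{R}$ that are non-anticipative, i.e. $H_i(\tilde S)=H_i(\hat S)$ whenever $\tilde S_k=\hat S_k$ for $j\le k\le i$. The following is assumed: (H.1) $\alpha\mathcal{H}_{(S,j)}+\mathcal{H}_{(S,j)}\subseteq\mathcal{H}_{(S,j)}$ for all $\alpha\ge0$; (H.2) every $(H_i)_{i\ge j}$ with each $H_i$ constant on $\mathcal{S}_{(S,j)}$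 with value $-1$, $0$ or $1$ belongs to $\mathcal{H}_{(S,j)}$; (H.3) if $(H_i)_{i\ge j}\in\mathcal{H}_{(S,j)}$ and $k\ge j$ then $(H_i|_{\mathcal{S}_{(S,k)}})_{i\ge k}\in\mathcal{H}_{(S,k)}$; (H.4) if $(H_i)_{i\ge j}\in\mathcal{H}_{(S,j)}$, $k\ge j$, $G_i=H_i$ for $j\le i\le k$ and $G_i=0$ for $i>k$, then $G\in\mathcal{H}_{(S,j)}$. Elementary functions. For $V\in\mathbb{R}$, $H\in\mathcal{H}_{(S,j)}$, $n\ge j$ let $\Pi^{V,H}_{j,n}(\tilde S)=V+\sum_{i=j}^{n-1}H_i(\tilde S)\Delta_i\tilde S$ for $\tilde S\in\mathcal{S}_{(S,j)}$; $\mathcal{D}_{(S,j)}$ is the set of all such functions, $\mathcal{D}_{(S,j)}^+$ its non-negative elements, $\mathcal{D}_{(S,j)}^-=-\mathcal{D}_{(S,j)}^+$. Standing assumption 1 (local $0$-neutrality): $\sup_{\tilde S\in\mathcal{S}_{(S,j)}}(\tilde S_{j+1}-S_j)\ge0\ge\inf_{\tilde S\in\mathcal{S}_{(S,j)}}(\tilde S_{j+1}-S_j)$ at every node. Then for $f=\Pi^{V,H}_{j,n}\in\mathcal{D}_{(S,j)}^+$ the value $I_jf(S)=V$ is well defined. Norm and a.e. $Q$ is the set of functions $\mathcal{S}\to[-\infty,\infty]$, $P\subseteq Q$ the non-negative ones. Conventions: $0\cdot\infty=0$, $\infty+(-\infty)=\infty$, $u-v=u+(-v)$, $\inf\emptyset=\infty$.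 For $f\in P$, $\overline{I}_jf(S)=\inf\{\sum_{m\ge1}V^m: f\le\sum_{m\ge1}f_m\text{ on }\mathcal{S}_{(S,j)},\ f_m=\Pi^{V^m,H^m}_{j,n_m}\in\mathcal{D}_{(S,j)}^+\}$; for $f\in Q$, $\|f\|_j(S)=\overline{I}_j|f|(S)$ and $\|f\|=\|f\|_0$ (a constant). $E\subseteq\mathcal{S}$ is null if $\|\mathbf{1}_E\|=0$; ''a.e.'' means off a null set, and $\doteq$ denotes equality a.e. Conditional integral. For $f\in Q$, $\overline{\sigma}_jf(S)=\inf\{\sum_{m\ge0}V^m: f\le\sum_{m\ge0}f_m\text{ on }\mathcal{S}_{(S,j)},\ f_0=\Pi^{V^0,H^0}_{j,n_0}\in\mathcal{D}_{(S,j)}^-,\ f_m=\Pi^{V^m,H^m}_{j,n_m}\in\mathcal{D}_{(S,j)}^+\ (m\ge1)\}$ (for $f_0\in\mathcal D_{(S,j)}^-=-\mathcal D_{(S,j)}^+$, $H^0$ is the negative of a portfolio and $V^0=-I_j(-f_0)(S)$), and $\underline{\sigma}_jf=-\overline{\sigma}_j(-f)$. Standing assumption 2: $\overline{\sigma}_j0=0$ on $\mathcal{S}$ for all $j\ge0$. $\mathcal{L}_{\overline{\sigma}_j}=\{f\in Q:\overline{\sigma}_jf-\underline{\sigma}_jf=0\text{ a.e.}\}$, and $\int_jf=\overline{\sigma}_jf$ (a function on $\mathcal{S}$, constant on each $\mathcal{S}_{(S,j)}$) for $f\in\mathcal{L}_{\overline{\sigma}_j}$. (Under the hypotheses $f\in\mathcal{L}_{\overline{\sigma}_i}$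 for all $i\ge0$.) *)

(* Defs.v *)
From mathcomp Require Import all_boot all_order all_algebra.
From mathcomp Require Import all_classical all_reals all_analysis.

Set Implicit Arguments.
Unset Strict Implicit.
Unset Printing Implicit Defensive.

Import Order.TTheory GRing.Theory Num.Theory.
Local Open Scope classical_set_scope.
Local Open Scope ring_scope.

(* A trajectory set is X : set (nat -> R); its coercion to a type makes S : X
   a trajectory with coordinates val S i. *)

Section TrajectoryMarket.
Variables (R : realType) (X : set (nat -> R)).

Definition node (S : X) (j : nat) : set X :=
  [set T | forall i, (i <= j)%N -> val T i = val S i].

Definition increment (i : nat) (S : X) : R := val S i.+1 - val S i.

(* A portfolio (H_i)_{i >= j} of functions on node S j is represented by a total
   family: values at i < j or outside node S j carry no meaning. *)
Definition portfolio := nat -> X -> R.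

(* portfolio_ext says that membership in Hp S j does not look at the meaningless
   values; with this encoding, restriction to a later node leaves the family H
   unchanged (portfolio_restr). *)
Record portfolio_family (Hp : X -> nat -> set portfolio) : Prop :=
  PortfolioFamily {
  portfolio_ext : forall S j (H G : portfolio), Hp S j H ->
    (forall i T, (j <= i)%N -> node S j T -> G i T = H i T) -> Hp S j G;
  portfolio_node : forall S T j, node S j T -> Hp T j = Hp S j;
  portfolio_nonanticipative : forall S j H, Hp S j H ->
    forall i T U, (j <= i)%N -> node S j T -> node S j U ->
      (forall k, (j <= k <= i)%N -> val T k = val U k) -> H i T = H i U;
  portfolio_cone : forall S j (a : R) H G, 0 <= a -> Hp S j H -> Hp S j G ->
    Hp S j (fun i T => a * H i T + G i T);
  portfolio_const : forall S j (H : portfolio),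
    (forall i, (j <= i)%N -> exists c : R, (c = -1 \/ c = 0 \/ c = 1) /\
       forall T, node S j T -> H i T = c) -> Hp S j H;
  portfolio_restr : forall S j k H, (j <= k)%N -> Hp S j H -> Hp S k H;
  portfolio_stop : forall S j k H, (j <= k)%N -> Hp S j H ->
    Hp S j (fun i T => if (i <= k)%N then H i T else 0) }.

Definition local_0_neutral :=
  forall (S : X) (j : nat),
    (0 <= ereal_sup [set (val T j.+1 - val S j)%:E | T in node S j])%E /\
    (ereal_inf [set (val T j.+1 - val S j)%:E | T in node S j] <= 0)%E.

Variable Hp : X -> nat -> set portfolio.

Definition wealth (V : R) (H : portfolio) (j n : nat) (T : X) : R :=
  V + \sum_(j <= i < n) H i T * increment i T.

(* The value I_j g (S) is carried along as the parameter V: elementary_pos S j V g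
   says that g is in D^+_(S,j) with I_j g (S) = V, elementary_neg S j V g that g is
   in D^-_(S,j) = - D^+_(S,j) with V = - I_j (- g) (S). Only g on node S j matters. *)
Definition elementary (S : X) (j : nat) (V : R) (g : X -> R) : Prop :=
  exists (H : portfolio) (n : nat), [/\ Hp S j H, (j <= n)%N &
    forall T, node S j T -> g T = wealth V H j n T].

Definition elementary_pos (S : X) (j : nat) (V : R) (g : X -> R) : Prop :=
  elementary S j V g /\ forall T, node S j T -> 0 <= g T.

Definition elementary_neg (S : X) (j : nat) (V : R) (g : X -> R) : Prop :=
  elementary_pos S j (- V) (fun T => - g T).

Definition I_bar (j : nat) (f : X -> \bar R) (S : X) : \bar R :=
  ereal_inf [set v | exists (V : nat -> R) (g : nat -> X -> R),
    [/\ forall m, (1 <= m)%N -> elementary_pos S j (V m) (g m),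
        forall T, node S j T -> (f T <= \sum_(1 <= m <oo) (g m T)%:E)%E &
        v = (\sum_(1 <= m <oo) (V m)%:E)%E]].

Definition cond_norm (j : nat) (f : X -> \bar R) (S : X) : \bar R :=
  I_bar j (fun T => `|f T|%E) S.

(* cond_norm 0 f is constant on X because all trajectories share the coordinate 0. *)
Definition null_function (f : X -> \bar R) : Prop :=
  forall S, cond_norm 0 f S = 0%E.

Definition null_set (E : set X) : Prop :=
  null_function (fun T => (\1_E T)%:E).

Definition almost_everywhere_traj (A : X -> Prop) : Prop :=
  exists E : set X, null_set E /\ forall S, ~ E S -> A S.

Definition sigma_bar (j : nat) (f : X -> \bar R) (S : X) : \bar R :=
  ereal_inf [set v | exists (V : nat -> R) (g : nat -> X -> R),
    [/\ elementary_neg S j (V 0%N) (g 0%N),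
        forall m, (1 <= m)%N -> elementary_pos S j (V m) (g m),
        forall T, node S j T ->
          (f T <= (g 0%N T)%:E + \sum_(1 <= m <oo) (g m T)%:E)%E &
        v = ((V 0%N)%:E + \sum_(1 <= m <oo) (V m)%:E)%E]].

Definition sigma_low (j : nat) (f : X -> \bar R) (S : X) : \bar R :=
  (- sigma_bar j (fun T => - f T) S)%E.

(* The dual subtraction %dE implements +oo + -oo = +oo and u - v = u + (- v). *)
Definition cond_integrable (j : nat) (f : X -> \bar R) : Prop :=
  almost_everywhere_traj
    (fun S => (sigma_bar j f S - sigma_low j f S)%dE = 0%E).

(* Meaningful for f in cond_integrable j only. *)
Definition cond_integral (j : nat) (f : X -> \bar R) : X -> \bar R :=
  sigma_bar j f.

End TrajectoryMarket.

(* Main.v *)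
Require Import Defs.
From mathcomp Require Import all_boot all_order all_algebra.
From mathcomp Require Import all_classical all_reals all_analysis.
Import Order.TTheory GRing.Theory Num.Theory DualAddTheory.
Set Implicit Arguments.
Unset Strict Implicit.
Unset Printing Implicit Defensive.
Local Open Scope classical_set_scope.
Local Open Scope ring_scope.

(** The conditional integral [sigma_bar] is monotone, subadditive for the
    addition with [+oo + -oo = +oo], and reproduces functions that are constant
    on the node: covers can be added term by term, and [sigma_bar] of zero is
    zero.  The remaining ingredient is the tower inequality ([sigma_bar_tower])
      [sigma_bar i (sigma_bar j f) <= sigma_bar i f]   for [i <= j]:
    a portfolio that superhedges [f] from time [i] on has at time [j] a wealth
    which is the price of superhedging [f] from each later node, and this wealth
    is again an elementary function with the same initial value.  Local
    neutrality enters here: it forces the wealth at time [j] to be nonnegative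
    as soon as the final wealth is.

    Write [gap j f = sigma_bar j f + sigma_bar j (- f)].  It is nonnegative, and
    [f] is integrable at time [j] iff [gap j f] vanishes almost everywhere.
    Subadditivity and the tower inequality give
      [sigma_bar 0 (gap j f) <= gap 0 f = 0],
    and since [sigma_bar 0] is the norm on nonnegative functions, [gap j f] is a
    null function.  A nonnegative function of norm zero vanishes off a null set
    by countable subadditivity of the norm ([I_bar_eq0_support]), so [f] is
    integrable at every time [j] ([cond_integrable_later]).

    At a node where [gap j f = 0] the tower inequalities for [f] and [- f]
    squeeze the iterated integral:
      [sigma_bar j f = - sigma_bar j (- f) <= - sigma_bar j (- sigma_bar k f)
         <= sigma_bar j (sigma_bar k f) <= sigma_bar j f]
    so that all terms agree ([gap_eq0_tower]).  Integrating in the other order is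
    trivial, as [sigma_bar j f] is constant on the nodes of time [k].

    For the last claim the same squeeze, applied to [|f|] with [j = 0], shows
    that the norm of [f] is the norm of its conditional norm at time [k], and the
    norm of a function vanishing almost everywhere is zero. *)

(** * Series and sums of extended reals *)

Lemma eseries1_succ (R : realType) (a : nat -> \bar R) :
  (forall m, 0 <= a m.+1)%E ->
  (\sum_(1 <= m <oo) a m = \sum_(m <oo) a m.+1)%E.
Proof.
move=> a0; pose b m := if m is m'.+1 then a m'.+1 else 0%E.
have b0 m : (0 <= b m)%E by case: m.
rewrite (_ : (\sum_(1 <= m <oo) a m)%E = (\sum_(1 <= m <oo) b m)%E); last first.
  by apply/congr_lim/funext => n; apply: eq_big_nat => -[].
rewrite -(nneseries_addn 1 b0); apply: eq_eseriesr => i _.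
by rewrite addn1.
Qed.

(** Merges countably many series indexed from 1 into a single one; this is how
    countably many covers are combined in [I_bar_eq0_support]. *)
Lemma eseries1_pair (R : realType) (a : nat -> nat -> \bar R)
    (e : nat -> nat * nat) :
  set_bij [set: nat] [set: nat * nat] e -> (forall k m, 0 <= a k m.+1)%E ->
  (\sum_(1 <= n <oo) a (e n.-1).1 (e n.-1).2.+1 =
   \sum_(k <oo) \sum_(1 <= m <oo) a k m)%E.
Proof.
move=> e_bij a0; rewrite eseries1_succ; last by move=> m; exact: a0.
rewrite nneseries_esumT //=.
rewrite -(reindex_esum _ _ _ (fun p => a p.1 p.2.+1) e_bij).
transitivity (\esum_(k in [set: nat]) \esum_(m in [set: nat]) a k m.+1)%E.
  rewrite esum_esum //; congr esum.
  by apply/seteqP; split => // -[].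
rewrite -nneseries_esumT; last by move=> k; apply: esum_ge0 => m _.
by apply: eq_eseriesr => k _; rewrite eseries1_succ // nneseries_esumT.
Qed.

Lemma eseries_cst_pinfty (R : realType) (x : \bar R) :
  (0 < x)%E -> (\sum_(k <oo) x = +oo)%E.
Proof.
move=> x0; apply/eqyP => A A0.
case: x x0 => [r| |] // r0; last first.
  by rewrite (@nneseries_pinfty _ _ _ 0%N) ?leey.
rewrite lte_fin in r0.
have /le_trans -> // : (A%:E <= \sum_(0 <= k < Num.bound (A / r)) r%:E)%E.
  rewrite sumEFin sumr_const_nat subn0 lee_fin -mulr_natl -ler_pdivrMr //.
  by rewrite ltW // archi_boundP // divr_ge0 // ltW.
by apply: nneseries_lim_ge => k _ _; rewrite lee_fin ltW.
Qed.

Lemma eqNy_le (R : realType) (x : \bar R) :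
  (forall r : R, x <= r%:E)%E -> x = -oo%E.
Proof.
case: x => [x| |] xr //; last by have := xr 0.
by have := xr (x - 1); rewrite lee_fin lerDl oppr_ge0 ler10.
Qed.

(** For the dual addition there is no side condition: if one infimum is [+oo] the
    right-hand side is [+oo], whatever the other one is. *)
Lemma le_dadd_ereal_inf (R : realType) (A B : set (\bar R)) (x : \bar R) :
  (forall a b, A a -> B b -> x <= a + b)%dE ->
  (x <= ereal_inf A + ereal_inf B)%dE.
Proof.
move=> xAB.
have key (r s : R) : (ereal_inf A < r%:E -> ereal_inf B < s%:E ->
    x <= (r + s)%:E)%E.
  move=> /ereal_inf_lt[a Aa ar] /ereal_inf_lt[b Bb bs].
  by apply: (le_trans (xAB a b Aa Bb)); exact: (lee_dD (ltW ar) (ltW bs)).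
case: (ereal_inf A) key => [a| |]; case: (ereal_inf B) => [b| |] //= key;
  rewrite ?leey //.
- apply/lee_addgt0Pr => e e0.
  have : (x <= ((a + e / 2) + (b + e / 2))%:E)%E.
    by apply: key; rewrite lte_fin ltrDl divr_gt0.
  by rewrite addrACA -splitr EFinD.
- rewrite leeNy_eq; apply/eqP/eqNy_le => r; rewrite -(subrKC (a + 1) r).
  by apply: key; rewrite ?ltNyr// lte_fin ltrDl.
- rewrite leeNy_eq; apply/eqP/eqNy_le => r; rewrite -(subrK (b + 1) r).
  by apply: key; rewrite ?ltNyr// lte_fin ltrDl.
- rewrite leeNy_eq; apply/eqP/eqNy_le => r; rewrite -(subrK r r).
  by apply: key; rewrite ltNyr.
Qed.

Lemma dadde_gtNy (R : realType) (x y : \bar R) :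
  (-oo < x)%E -> (-oo < y)%E -> (x + y)%dE = (x + y)%E.
Proof. by case: x y => [x| |] [y| |]. Qed.

Lemma dadde_eq0 (R : realType) (x y : \bar R) :
  (x + y)%dE = 0%E -> x \is a fin_num /\ x = (- y)%E.
Proof.
case: x y => [x| |] [y| |] //= [/eqP].
by rewrite addr_eq0 => /eqP ->.
Qed.

Lemma dadde_ge0 (R : realType) (x y : \bar R) :
  (0 <= (x + y)%dE)%E -> (- y <= x)%E.
Proof.
case: x y => [x| |] [y| |] //=; rewrite ?leey ?leNye // !lee_fin.
by rewrite -lerBlDr sub0r.
Qed.

(** * Elementary functions at a node *)

Section Elementary.
Variables (R : realType) (X : set (nat -> R)).
Variable (Hp : X -> nat -> set (portfolio X)).
Hypotheses (Hp_family : portfolio_family Hp) (X_neutral : local_0_neutral X).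
Implicit Types (S T U : X) (H : portfolio X) (V : R) (g : X -> R).

Lemma node_refl S j : node S j S. Proof. by []. Qed.

Lemma node_eq S T j : node S j T -> node T j = node S j.
Proof.
move=> ST; apply/seteqP; split => U /= h i ij; first by rewrite h // ST.
by rewrite h // ST.
Qed.

Lemma node_trans S T U i j : (i <= j)%N -> node S i T -> node T j U -> node S i U.
Proof.
move=> ij ST TU m mi; rewrite TU ?ST //; exact: leq_trans mi ij.
Qed.

Lemma portfolio_later S T i j H :
  (i <= j)%N -> node S i T -> Hp S i H -> Hp T j H.
Proof.
move=> ij ST HH; apply: (portfolio_restr Hp_family ij).
by rewrite (portfolio_node Hp_family ST).
Qed.

Lemma portfolio0 S j : Hp S j (fun _ _ => 0).
Proof.
by apply: (portfolio_const Hp_family) => i _; exists 0; split; [right; left|].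
Qed.

Lemma wealth_cat V H i m n T : (i <= m)%N -> (m <= n)%N ->
  wealth V H i n T = wealth (wealth V H i m T) H m n T.
Proof. by move=> im mn; rewrite /wealth -addrA -big_cat_nat. Qed.

Lemma wealth_node V H S T U i m : Hp S i H -> (i <= m)%N -> node S i T ->
  node T m U -> wealth V H i m U = wealth V H i m T.
Proof.
move=> HH im ST TU; congr (_ + _); apply: eq_big_nat => l /andP[il lm].
have SU := node_trans im ST TU.
congr (_ * _); last by rewrite /increment !TU // ltnW.
apply: (portfolio_nonanticipative Hp_family HH il SU ST) => q /andP[_ ql].
by apply: TU; exact: (leq_trans ql (ltnW lm)).
Qed.

(** Whatever position [c] is held, local neutrality offers a next move whose gain
    is as close to nonpositive as desired. *)
Lemma neutral_step S j (c e : R) : 0 < e ->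
  exists2 T, node S j T & c * (val T j.+1 - val S j) < e.
Proof.
move=> e0; have [sup_ge0 inf_le0] := X_neutral S j.
have [c0|c0|->] := ltrgtP c 0.
- have : ((e / c)%:E < ereal_sup
      [set (val T j.+1 - val S j)%:E | T in node S j])%E.
    apply: lt_le_trans sup_ge0; rewrite lte_fin.
    by rewrite pmulr_rlt0 // invr_lt0.
  move=> /ereal_sup_gt[_ [T ST <-]]; rewrite lte_fin => h; exists T => //.
  by rewrite mulrC -ltr_ndivrMr.
- have : (ereal_inf [set (val T j.+1 - val S j)%:E | T in node S j] <
      (e / c)%:E)%E.
    by apply: (le_lt_trans inf_le0); rewrite lte_fin divr_gt0.
  move=> /ereal_inf_lt[_ [T ST <-]]; rewrite lte_fin => h; exists T => //.
  by rewrite mulrC -ltr_pdivlMr.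
- by exists S => //; rewrite mul0r.
Qed.

(** Backward induction: were the wealth negative at time [q], [neutral_step] would
    continue the trajectory with a gain too small to make it nonnegative again at
    time [q.+1]. *)
Lemma wealth_ge0_before S i n V H : Hp S i H ->
  (forall T, node S i T -> 0 <= wealth V H i n T) ->
  forall m, (i <= m <= n)%N -> forall T, node S i T -> 0 <= wealth V H i m T.
Proof.
move=> HH pos m /andP[im mn]; rewrite -(subnKC mn) in pos.
elim: (n - m)%N pos => [|d IHd] pos; first by rewrite addn0 in pos.
apply: IHd => T ST; set q := (m + d)%N in pos *.
have iq : (i <= q)%N by rewrite (leq_trans im) // leq_addr.
rewrite leNgt; apply/negP => neg.
have [U TU U_lt] := neutral_step T q (H q T) (etrans (oppr_gt0 _) neg).
have SU := node_trans iq ST TU.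
have := pos U SU; rewrite addnS (wealth_cat _ _ _ iq (leqnSn q)).
rewrite (wealth_node _ HH iq ST TU) /wealth big_nat1 -/(wealth V H i q T).
rewrite (_ : H q U = H q T); last first.
  apply: (portfolio_nonanticipative Hp_family HH iq SU ST) => l /andP[_ lq].
  exact: TU.
by rewrite /increment (TU q (leqnn q)) leNgt -ltrBrDl sub0r U_lt.
Qed.

(** The function [g'] is the wealth at time [j] of the portfolio generating [g],
    that is, the conditional value of [g] at time [j]: it costs the same as [g] at
    time [i], and it is the price of [g] at every later node of time [j]. *)
Lemma elementary_conditional S i j V g :
  (i <= j)%N -> elementary_pos Hp S i V g ->
  exists2 g', elementary_pos Hp S i V g' &
    forall T, node S i T -> elementary_pos Hp T j (g' T) g.
Proof.
move=> ij [[H [n [HH in_ gE]]] g0]; have i_min : (i <= minn n j)%N.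
  by rewrite leq_min in_.
(* If the portfolio stops at [n < j], its final wealth is already known. *)
exists (wealth V H i (minn n j)).
  split; first by exists H, (minn n j).
  apply: (wealth_ge0_before (n := n) HH); last by rewrite i_min geq_minl.
  by move=> T ST; rewrite -gE // g0.
move=> T ST; split; last by move=> U TU; exact/g0/(node_trans ij ST TU).
have [nj|/ltnW jn] := leqP n j.
- exists (fun _ _ => 0), j; split=> //; first exact: portfolio0.
  move=> U TU; have SU := node_trans ij ST TU.
  rewrite gE // [RHS]/wealth big_geq // addr0.
  by apply: (wealth_node _ HH in_ ST) => q qn; apply: TU; exact: leq_trans qn nj.
- exists H, n; split => //; first exact: portfolio_later ij ST HH.
  move=> U TU; have SU := node_trans ij ST TU.
  by rewrite gE // (wealth_cat _ _ _ ij jn) (wealth_node _ HH ij ST TU).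
Qed.

Lemma elementary_pos_value_ge0 S j V g : elementary_pos Hp S j V g -> 0 <= V.
Proof.
move=> [[H [n [HH jn gE]]] g0].
have pos T : node S j T -> 0 <= wealth V H j n T.
  by move=> ST; rewrite -gE // g0.
have := wealth_ge0_before HH pos (m := j) _ (@node_refl S j).
by rewrite leqnn jn /wealth big_geq // addr0; apply.
Qed.

(** A portfolio stopped at its horizon generates the same function at any larger
    horizon; so two elementary functions can be given a common one. *)
Lemma elementary_horizon S j V g : elementary Hp S j V g ->
  exists n0, forall n, (n0 <= n)%N -> exists2 H, Hp S j H &
    forall T, node S j T -> g T = wealth V H j n T.
Proof.
move=> [H [n0 [HH jn0 gE]]]; exists n0 => n n0n.
have [n0j|jn0'] := leqP n0 j.
  exists (fun _ _ => 0) => [|T ST]; first exact: portfolio0.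
  rewrite gE // [LHS]/wealth big_geq // /wealth big1 // => i _.
  by rewrite mul0r.
exists (fun i T => if (i <= n0.-1)%N then H i T else 0).
  by apply: (portfolio_stop Hp_family) => //; rewrite -ltnS (ltn_predK jn0').
have stopE i : (i <= n0.-1)%N = (i < n0)%N by rewrite -ltnS (ltn_predK jn0').
move=> T ST; rewrite gE // (wealth_cat _ _ _ jn0 n0n) {2}/wealth.
rewrite [X in _ + X]big_nat_cond [X in _ + X]big1 ?addr0; last first.
  move=> i /andP[/andP[n0i _] _].
  by rewrite stopE ltnNge n0i mul0r.
by congr (_ + _); apply: eq_big_nat => i /andP[_ i_lt]; rewrite stopE i_lt.
Qed.

Lemma elementary_pos_add S j V V' g g' :
  elementary_pos Hp S j V g -> elementary_pos Hp S j V' g' ->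
  elementary_pos Hp S j (V + V') (fun T => g T + g' T).
Proof.
move=> [/elementary_horizon[n1 gE] g0] [/elementary_horizon[n2 g'E] g'0].
split; last by move=> T ST; rewrite addr_ge0 ?g0 ?g'0.
pose n := maxn j (maxn n1 n2).
have [|H HH HE] := gE n; first by rewrite /n !leq_max leqnn orbT.
have [|H' HH' HE'] := g'E n; first by rewrite /n !leq_max leqnn !orbT.
exists (fun i T => 1 * H i T + H' i T), n; split.
- exact: (portfolio_cone Hp_family ler01).
- by rewrite leq_maxl.
move=> T ST; rewrite HE // HE' // /wealth addrACA -big_split /=; congr (_ + _).
by apply: eq_bigr => i _; rewrite mul1r mulrDl.
Qed.

Lemma elementary_pos_cst S j V : 0 <= V -> elementary_pos Hp S j V (fun=> V).
Proof.
move=> V0; split=> //; exists (fun _ _ => 0), j; split=> //.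
- exact: portfolio0.
- by move=> T _; rewrite /wealth big_geq // addr0.
Qed.

Lemma elementary_neg_add S j V V' g g' :
  elementary_neg Hp S j V g -> elementary_neg Hp S j V' g' ->
  elementary_neg Hp S j (V + V') (fun T => g T + g' T).
Proof.
move=> hg hg'; rewrite /elementary_neg opprD.
rewrite (_ : (fun _ => _) = fun T => - g T + - g' T).
  exact: elementary_pos_add.
by apply/funext => T; rewrite opprD.
Qed.

Lemma eseries_value_ge0 S j (V : nat -> R) (g : nat -> X -> R) :
  (forall m, (1 <= m)%N -> elementary_pos Hp S j (V m) (g m)) ->
  (0 <= \sum_(1 <= m <oo) (V m)%:E)%E.
Proof.
move=> hg; apply: nneseries_ge0 => m m1 _.
by rewrite lee_fin (elementary_pos_value_ge0 (hg m m1)).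
Qed.

(** * The conditional integral and the norm *)

Lemma sigma_bar_le j (f g : X -> \bar R) S :
  (forall T, node S j T -> (f T <= g T)%E) ->
  (sigma_bar Hp j f S <= sigma_bar Hp j g S)%E.
Proof.
move=> fg; apply: ereal_inf_le_tmp => _ [V [p [p0 pm gle ->]]].
exists V, p; split => // T ST; exact: le_trans (fg T ST) (gle T ST).
Qed.

Lemma sigma_bar_node j (f : X -> \bar R) S T :
  node S j T -> sigma_bar Hp j f T = sigma_bar Hp j f S.
Proof.
move=> ST; rewrite /sigma_bar /elementary_neg /elementary_pos /elementary.
by rewrite (node_eq ST) (portfolio_node Hp_family ST).
Qed.

Lemma sigma_bar_dadd j (f g : X -> \bar R) S :
  (sigma_bar Hp j (fun T => (f T + g T)%dE) S <=
   (sigma_bar Hp j f S + sigma_bar Hp j g S)%dE)%E.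
Proof.
apply: le_dadd_ereal_inf.
move=> _ _ [V [p [p0 pm fle ->]]] [W [q [q0 qm gle ->]]].
have gtNy (x : R) (y : \bar R) : (0 <= y -> -oo < x%:E + y)%E.
  by case: y => // y _; rewrite -EFinD ltNyr.
have V0 := eseries_value_ge0 pm; have W0 := eseries_value_ge0 qm.
rewrite dadde_gtNy ?gtNy // addeACA -EFinD -nneseriesD; last 2 first.
- by move=> m m1 _; rewrite lee_fin (elementary_pos_value_ge0 (pm m m1)).
- by move=> m m1 _; rewrite lee_fin (elementary_pos_value_ge0 (qm m m1)).
apply: ereal_inf_lbound; exists (V \+ W), (fun m T => p m T + q m T).
split => //=.
- exact: elementary_neg_add.
- by move=> m m1; apply: elementary_pos_add; [exact: pm|exact: qm].
- move=> T ST; have p_ge0 m : (1 <= m)%N -> (0 <= (p m T)%:E)%E.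
    by move=> m1; rewrite lee_fin (pm m m1).2.
  have q_ge0 m : (1 <= m)%N -> (0 <= (q m T)%:E)%E.
    by move=> m1; rewrite lee_fin (qm m m1).2.
  apply: (le_trans (lee_dD (fle T ST) (gle T ST))).
  rewrite dadde_gtNy ?gtNy ?nneseries_ge0 //; try by move=> m m1 _; auto.
  by rewrite addeACA -EFinD -nneseriesD // => m m1 _; auto.
Qed.

(** Replacing each function of a cover of [f] at time [i] by its conditional value
    at time [j] yields a cover of [sigma_bar j f] with the same total price. *)
Lemma sigma_bar_tower i j (f : X -> \bar R) S : (i <= j)%N ->
  (sigma_bar Hp i (sigma_bar Hp j f) S <= sigma_bar Hp i f S)%E.
Proof.
move=> ij; apply: le_ereal_inf_tmp => _ [V [g [g0 gm fle ->]]].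
have [c0 c0V c0g] := elementary_conditional ij g0.
have /choice[c cP] : forall m, exists cm : X -> R, (1 <= m)%N ->
    elementary_pos Hp S i (V m) cm /\
    forall T, node S i T -> elementary_pos Hp T j (cm T) (g m).
  move=> m.
  have [m1|] := leqP 1 m; last by exists (fun=> 0).
  by have [cm cV cg] := elementary_conditional ij (gm m m1); exists cm.
pose d m T := if m is 0%N then - c0 T else c m T.
apply: ereal_inf_lbound; exists V, d; split => //.
- rewrite /elementary_neg /d (_ : (fun _ => _) = c0) //.
  by apply/funext => T; rewrite opprK.
- by case=> // m _; exact: (cP m.+1 isT).1.
move=> T ST; apply: ereal_inf_lbound; exists (d^~ T), g; split => //.
- by rewrite /elementary_neg /d opprK; exact: c0g.
- by case=> // m _; exact: (cP m.+1 isT).2.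
- by move=> U TU; exact/fle/(node_trans ij ST TU).
Qed.

Lemma sigma_bar_le_cst j (f : X -> \bar R) (c : R) S :
  (forall T, node S j T -> (f T <= c%:E)%E) -> (sigma_bar Hp j f S <= c%:E)%E.
Proof.
move=> fc.
(* The negative part of [c] goes to the term in D^-, the positive part to D^+. *)
pose V m : R := if m is m'.+1 then if m' is 0%N then Num.max c 0 else 0
  else Num.min c 0.
have V_ge0 m : 0 <= V m.+1 by case: m => //=; rewrite le_max lexx orbT.
have VE : ((V 0%N)%:E + \sum_(1 <= m <oo) (V m)%:E = c%:E)%E.
  rewrite eseries1_succ // nneseries_recl //; last by move=> m _; rewrite lee_fin.
  rewrite eseries0 ?adde0 -?EFinD; last by case.
  by congr EFin; rewrite addrC addr_max_min addr0.
apply: ereal_inf_lbound; exists V, (fun m _ => V m); split => //.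
- by apply: elementary_pos_cst; rewrite oppr_ge0 ge_min lexx orbT.
- by case=> // m _; exact: elementary_pos_cst.
- by move=> T ST; rewrite VE fc.
Qed.

Lemma I_bar_ge0 j (f : X -> \bar R) S : (0 <= I_bar Hp j f S)%E.
Proof.
by apply: le_ereal_inf_tmp => _ [V [g [gm _ ->]]]; exact: eseries_value_ge0 gm.
Qed.

(** If [f >= 0] has norm zero, so has the sum of infinitely many copies of [f],
    which is [+oo] wherever [f] does not vanish and so dominates [g].  The [k]-th
    copy is covered at price at most [e / 2 ^ k.+1], and all these covers together
    form one cover of price at most [e]. *)
Lemma I_bar_eq0_support j (f g : X -> \bar R) S :
  (forall T, (0 <= f T)%E) -> (forall T, f T = 0%E -> (g T <= 0)%E) ->
  I_bar Hp j f S = 0%E -> I_bar Hp j g S = 0%E.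
Proof.
move=> f0 gf If0; apply/eqP; rewrite eq_le I_bar_ge0 andbT.
apply/lee_addgt0Pr => e e0; rewrite add0e.
have eps_gt0 k : 0 < e / (2 ^ k.+1)%:R by rewrite divr_gt0 // ltr0n expn_gt0.
have /choice[C CP] : forall k, exists Ck : (nat -> R) * (nat -> X -> R),
    [/\ forall m, (1 <= m)%N -> elementary_pos Hp S j (Ck.1 m) (Ck.2 m),
        forall T, node S j T -> (f T <= \sum_(1 <= m <oo) (Ck.2 m T)%:E)%E &
        (\sum_(1 <= m <oo) (Ck.1 m)%:E <= (e / (2 ^ k.+1)%:R)%:E)%E].
  move=> k.
  have : (I_bar Hp j f S < (e / (2 ^ k.+1)%:R)%:E)%E by rewrite If0 lte_fin.
  move=> /ereal_inf_lt[_ [V [p [pm fle ->]]] /ltW ltV].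
  by exists (V, p).
have /card_esym/card_set_bijP[e' e_bij] := card_nat2.
apply: (@le_trans _ _
  (\sum_(1 <= n <oo) ((C (e' n.-1).1).1 (e' n.-1).2.+1)%:E)%E).
  apply: ereal_inf_lbound.
  exists (fun n => (C (e' n.-1).1).1 (e' n.-1).2.+1),
    (fun n => (C (e' n.-1).1).2 (e' n.-1).2.+1); split => //.
    by move=> m _; have [Cpos _ _] := CP (e' m.-1).1; exact: Cpos.
  move=> T ST.
  have C_ge0 k m : (0 <= ((C k).2 m.+1 T)%:E)%E.
    by have [Cpos _ _] := CP k; rewrite lee_fin (Cpos m.+1 isT).2.
  rewrite (eseries1_pair (a := fun k m => ((C k).2 m T)%:E) e_bij) //.
  have [fT0|fT0] := eqVneq (f T) 0%E.
    apply: (le_trans (gf T fT0)); apply: nneseries_ge0 => k _ _.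
    by rewrite eseries1_succ // nneseries_ge0.
  apply: (@le_trans _ _ (\sum_(k <oo) f T)%E); last first.
    by apply: lee_nneseries => // k _; have [_ fC _] := CP k; exact: fC.
  suff -> : (\sum_(k <oo) f T = +oo)%E by rewrite leey.
  by apply: eseries_cst_pinfty; rewrite lt0e fT0 f0.
rewrite (eseries1_pair (a := fun k m => ((C k).1 m)%:E) e_bij); last first.
  move=> k m; have [Cpos _ _] := CP k.
  by rewrite lee_fin (elementary_pos_value_ge0 (Cpos m.+1 isT)).
apply: le_trans (epsilon_trick0 xpredT (ltW e0)).
apply: lee_nneseries => k _.
  by have [Cpos _ _] := CP k => _; exact: eseries_value_ge0 Cpos.
by have [_ _] := CP k.
Qed.

End Elementary.


(** * The tower property *)

Section TowerProperty.
Variables (R : realType) (X : set (nat -> R)).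
Variable (Hp : X -> nat -> set (portfolio X)).
Hypotheses (Hp_family : portfolio_family Hp) (X_neutral : local_0_neutral X).
Hypothesis sigma_bar_0 :
  forall (j : nat) (S : X), sigma_bar Hp j (fun _ => 0%E) S = 0%E.

(** The lower bound is where [sigma_bar_0] is needed: by subadditivity
    [0 <= sigma_bar f + sigma_bar (- c)], and [sigma_bar (- c) <= - c]. *)
Lemma sigma_bar_cst j (f : X -> \bar R) c S :
  (forall T, node S j T -> f T = c) -> sigma_bar Hp j f S = c.
Proof.
have real_case (g : X -> \bar R) (r : R) :
    (forall T, node S j T -> g T = r%:E) -> sigma_bar Hp j g S = r%:E.
  move=> gr; apply/eqP; rewrite eq_le; apply/andP; split.
    by apply: sigma_bar_le_cst => // T ST; rewrite gr.
  have : (0 <= (sigma_bar Hp j g S + (- r)%:E)%dE)%E.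
    rewrite -(sigma_bar_0 j S); apply: (@le_trans _ _
      (sigma_bar Hp j (fun T => (g T + (- r)%:E)%dE) S)).
      apply: sigma_bar_le => T ST.
      by rewrite gr // -dEFinD subrr.
    apply: le_trans (sigma_bar_dadd Hp_family X_neutral _ _ _ _) _.
    by apply: lee_dD => //; exact: sigma_bar_le_cst.
  by move=> /dadde_ge0; rewrite EFinN oppeK.
case: c => [r fr| foo| fNoo]; first exact: real_case.
- apply/eqyP => A _; rewrite -(real_case (cst A%:E) A) //.
  by apply: sigma_bar_le => T ST; rewrite foo // leey.
- apply: eqNy_le => A.
  by apply: sigma_bar_le_cst => // T ST; rewrite fNoo // leNye.
Qed.

Definition gap j (f : X -> \bar R) (S : X) : \bar R :=
  (sigma_bar Hp j f S + sigma_bar Hp j (fun T => - f T)%E S)%dE.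

(** The convention [+oo + -oo = +oo] makes [f + (- f)] nonnegative even where [f]
    is infinite. *)
Lemma gap_ge0 j f S : (0 <= gap j f S)%E.
Proof.
rewrite -(sigma_bar_0 j S).
apply: le_trans (sigma_bar_dadd Hp_family X_neutral _ _ _ _).
apply: sigma_bar_le => T _; case: (f T) => [r| |]; try exact: leey.
by rewrite /= -dEFinD subrr.
Qed.

Lemma cond_integrableE j f :
  cond_integrable Hp j f = almost_everywhere_traj Hp (fun S => gap j f S = 0%E).
Proof.
by congr almost_everywhere_traj; apply/funext => S; rewrite /sigma_low oppeK.
Qed.

Lemma ae_sub (A B : X -> Prop) : (forall S, A S -> B S) ->
  almost_everywhere_traj Hp A -> almost_everywhere_traj Hp B.
Proof. by move=> AB [E [E0 EA]]; exists E; split => // S /EA/AB. Qed.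

Hypothesis I_bar_sigma_bar : forall (i : nat) (g : X -> \bar R),
  (forall S, (0 <= g S)%E) -> forall S, I_bar Hp i g S = sigma_bar Hp i g S.

(** The whole trajectory set is not null, because its indicator has norm 1. *)
Lemma ae_nonempty (A : X -> Prop) : X !=set0 ->
  almost_everywhere_traj Hp A -> exists S, A S.
Proof.
move=> [S0 XS0] [E [E0 EA]]; apply: contrapT => nA.
have ET S : E S by apply: contrapT => /EA AS; apply: nA; exists S.
have := E0 (SigSub (mem_set XS0)).
rewrite /cond_norm I_bar_sigma_bar // (@sigma_bar_cst _ _ 1%E).
  by move=> /eqP; rewrite onee_eq0.
by move=> T _; rewrite indicE mem_set // abse1.
Qed.

Lemma ae_eq0_of_I_bar (h : X -> \bar R) : (forall S, (0 <= h S)%E) ->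
  (forall S, I_bar Hp 0 h S = 0%E) ->
  almost_everywhere_traj Hp (fun S => h S = 0%E).
Proof.
move=> h0 Ih0; exists [set S | h S <> 0%E]; split; last by move=> S /contrapT.
move=> S; apply: (I_bar_eq0_support Hp_family X_neutral h0 _ (Ih0 S)) => T hT.
by rewrite indicE memNset ?abse0 // => -[].
Qed.

Lemma I_bar_of_ae_eq0 (h : X -> \bar R) S :
  almost_everywhere_traj Hp (fun S => h S = 0%E) -> I_bar Hp 0 h S = 0%E.
Proof.
move=> [E [E0 Eh]].
apply: (I_bar_eq0_support Hp_family X_neutral _ _ (E0 S)) => // T.
have [TE|/negP TE] := boolP (T \in E).
  by rewrite indicE TE abse1 => /eqP; rewrite onee_eq0.
by rewrite Eh // => ET; apply: TE; rewrite inE.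
Qed.

Variable (s0 : R).
Hypotheses (X_nonempty : X !=set0)
  (X_start : forall S : nat -> R, X S -> S 0%N = s0).

Lemma node0 (S T : X) : node S 0 T.
Proof.
by case=> // _; rewrite !X_start //; [exact: (set_valP S)|exact: (set_valP T)].
Qed.

(** At time 0 there is a single node, so [gap 0 f] is constant and vanishes
    everywhere as soon as it vanishes somewhere; it bounds the norm of
    [gap j f]. *)
Lemma cond_integrable_later j f :
  cond_integrable Hp 0 f -> cond_integrable Hp j f.
Proof.
rewrite !cond_integrableE => /(ae_nonempty X_nonempty)[S0 gap0].
apply: ae_eq0_of_I_bar => [S|S]; first exact: gap_ge0.
rewrite I_bar_sigma_bar; last by move=> T; exact: gap_ge0.
apply/eqP; rewrite eq_le -{2}(sigma_bar_0 0 S).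
rewrite [X in _ && X]sigma_bar_le ?andbT; last by move=> T _; exact: gap_ge0.
apply: le_trans (sigma_bar_dadd Hp_family X_neutral _ _ _ _) _.
rewrite -gap0 /gap -!(sigma_bar_node Hp_family _ (node0 S S0)).
by apply: lee_dD; exact: sigma_bar_tower.
Qed.

(** The chain of inequalities displayed at the top; it needs
    [- sigma_bar k f <= sigma_bar k (- f)], which is [gap_ge0]. *)
Lemma gap_eq0_tower j k f S : (j <= k)%N -> gap j f S = 0%E ->
  sigma_bar Hp j f S = sigma_bar Hp j (sigma_bar Hp k f) S /\
  gap j (sigma_bar Hp k f) S = 0%E.
Proof.
move=> jk /dadde_eq0[x_fin xE].
set g := sigma_bar Hp k f.
have low : (sigma_bar Hp j (fun T => - g T)%E S <= - sigma_bar Hp j f S)%E.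
  rewrite xE oppeK.
  apply: le_trans (sigma_bar_tower Hp_family X_neutral (fun T => - f T)%E S jk).
  apply: sigma_bar_le => T _; rewrite leeNl.
  exact: dadde_ge0 (gap_ge0 k f T).
have mid := dadde_ge0 (gap_ge0 j g S).
have up : (sigma_bar Hp j g S <= sigma_bar Hp j f S)%E by exact: sigma_bar_tower.
have gE : sigma_bar Hp j f S = sigma_bar Hp j g S.
  apply/eqP; rewrite eq_le up andbT; apply: le_trans mid.
  by rewrite leeNr.
split=> //; apply/eqP; rewrite eq_le gap_ge0 andbT /gap -gE.
apply: (le_trans (lee_dD (lexx _) low)).
by case: (sigma_bar Hp j f S) x_fin => //= r _; rewrite -dEFinD subrr.
Qed.

(** [sigma_bar 0 |f| = sigma_bar 0 (sigma_bar k |f|)] holds everywhere, and the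
    right-hand side is the norm of a function that vanishes almost everywhere. *)
Lemma null_of_ae_cond_norm0 k f :
  cond_integrable Hp 0 (fun S => `|f S|%E) ->
  almost_everywhere_traj Hp (fun S => cond_norm Hp k f S = 0%E) ->
  null_function Hp f.
Proof.
move=> f_int fk0 S; rewrite /cond_norm I_bar_sigma_bar //.
have [S0 gap0] : exists S0, gap 0 (fun S => `|f S|%E) S0 = 0%E.
  by apply: ae_nonempty => //; rewrite -cond_integrableE.
rewrite (sigma_bar_node Hp_family _ (node0 S0 S)).
have [-> _] := gap_eq0_tower (leq0n k) gap0.
have -> : sigma_bar Hp k (fun S => `|f S|%E) = cond_norm Hp k f.
  by apply/funext => T; rewrite /cond_norm I_bar_sigma_bar.
rewrite -I_bar_sigma_bar; last by move=> T; exact: I_bar_ge0.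
exact: I_bar_of_ae_eq0.
Qed.

End TowerProperty.

Theorem corollary7 (R : realType) (s0 : R) (X : set (nat -> R))
    (X_nonempty : X !=set0)
    (X_start : forall S : nat -> R, X S -> S 0%N = s0)
    (Hp : X -> nat -> set (portfolio X))
    (Hp_family : portfolio_family Hp)
    (X_neutral : local_0_neutral X)
    (sigma_bar_0 : forall (j : nat) (S : X), sigma_bar Hp j (fun _ => 0%E) S = 0%E)
    (I_bar_sigma_bar : forall (i : nat) (g : X -> \bar R),
       (forall S, (0 <= g S)%E) ->
       forall S, I_bar Hp i g S = sigma_bar Hp i g S)
    (f : X -> \bar R) (f_int : cond_integrable Hp 0 f)
    (j k : nat) (le_jk : (j <= k)%N) :
  ([/\ cond_integrable Hp j f, cond_integrable Hp k f,
       cond_integrable Hp k (cond_integral Hp j f) &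
       cond_integrable Hp j (cond_integral Hp k f)] /\
   (forall S, cond_integral Hp k (cond_integral Hp j f) S = cond_integral Hp j f S) /\
   almost_everywhere_traj Hp (fun S =>
     cond_integral Hp j f S = cond_integral Hp j (cond_integral Hp k f) S)) /\
  (cond_integrable Hp 0 (fun S => `|f S|%E) ->
   almost_everywhere_traj Hp (fun S => cond_norm Hp k f S = 0%E) ->
   null_function Hp f).
Proof.
have int_later i : cond_integrable Hp i f.
  exact: (cond_integrable_later Hp_family X_neutral sigma_bar_0
    I_bar_sigma_bar X_nonempty X_start).
have gapj : almost_everywhere_traj Hp (fun S => gap Hp j f S = 0%E).
  by rewrite -cond_integrableE.
have jf_cst S T : node S k T -> sigma_bar Hp j f T = sigma_bar Hp j f S.
  by move=> ST; exact/(sigma_bar_node Hp_family)/(node_trans le_jk _ ST).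
have sigma_cst := sigma_bar_cst Hp_family X_neutral sigma_bar_0.
split; last exact: (null_of_ae_cond_norm0 Hp_family X_neutral sigma_bar_0
    I_bar_sigma_bar X_nonempty X_start).
split; [split=> //|split].
- rewrite cond_integrableE; apply: ae_sub gapj => S /dadde_eq0[x_fin _].
  rewrite /gap /cond_integral (sigma_cst _ _ _ _ (jf_cst S)).
  rewrite (sigma_cst k _ (- sigma_bar Hp j f S)%E); last first.
    by move=> T ST; rewrite (jf_cst _ _ ST).
  by case: (sigma_bar Hp j f S) x_fin => //= r _; rewrite -dEFinD subrr.
- rewrite cond_integrableE; apply: ae_sub gapj => S gap0.
  by case: (gap_eq0_tower Hp_family X_neutral sigma_bar_0 le_jk gap0).
- by move=> S; apply: sigma_cst => T; exact: jf_cst.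
- apply: ae_sub gapj => S gap0.
  by case: (gap_eq0_tower Hp_family X_neutral sigma_bar_0 le_jk gap0).
Qed.
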